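(* Let $\ell,u\in\mathbb{R}$ with $-\infty<\ell\le u<+\infty$ and let $\nu$ be a positive integer. Then $$\mathcal{S}_{[\ell,u]}\subseteq D^+_\nu(\ell,u)\subseteq D_\nu(\ell,u).$$ Suppose moreover that $\nu\ge 2$. Then for any $(x,y)\in D_\nu(\ell,u)$, $$\left|\sqrt{y}-|x|\right|\le \frac{\max(\ell^2,u^2)+1}{2^{\nu-1}},\qquad |y-x^2|\le\frac{\left[\max(\ell^2,u^2)+1\right]^2}{2^{2\nu-2}}.$$ Further, if $(x,y)\in D^+_\nu(\ell,u)$, then $y\ge x^2$ and the same two bounds hold.
   Context: For real $\ell\le u$ let $\mathcal{S}_{[\ell,u]}=\{(x,y)\in\mathbb{R}^2 : y=x^2,\ x\in[\ell,u]\}$ and $B_{[\ell,u]}=\{(x,y)\in\mathbb{R}^2 : x\in[\ell,u],\ 0\le y\le(\ell+u)x-\ell u\}$. Angles. For $t\in\mathbb{R}$ put $\Theta(t)=\arctan\frac{t^2-1}{2t}$ if $t>0$, $\Theta(0)=-\frac{\pi}{2}$, and $\Theta(t)=\arctan\frac{t^2-1}{2t}-\pi$ if $t<0$, where $\arctan$ takes values in $(-\frac\pi2,\frac\pi2)$. Let $\theta_{min}=\Theta(\ell)$, $\theta_{max}=\Theta(u)$, $\theta_{mid}=(\theta_{min}+\theta_{max})/2$, $\theta_d=\theta_{max}-\theta_{min}$. Transformations of $\mathbb{R}^2$: clockwise rotation $\mathrm{Rot}([v,w]^T;\theta)=[\cos(\theta)v+\sin(\theta)w,\ -\sin(\theta)v+\cos(\theta)w]^T$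 and folding $\mathrm{Fold}([v,w]^T)=[v,|w|]^T$. Given $(x,y)$ and a positive integer $\nu$, consider the following conditions on real numbers $\xi_j,\eta_j$, $j=1,\dots,\nu$: (1) $[\xi_1,\eta_1]^T=\mathrm{Fold}\big(\mathrm{Rot}([x,(y-1)/2]^T;\theta_{mid})\big)$; (2) $[\xi_{j+1},\eta_{j+1}]^T=\mathrm{Fold}\big(\mathrm{Rot}([\xi_j,\eta_j]^T;\theta_d/2^{j+1})\big)$ for $j=1,\dots,\nu-1$; (3) $\xi_\nu\cos\left(\frac{\theta_d}{2^{\nu+1}}\right)+\eta_\nu\sin\left(\frac{\theta_d}{2^{\nu+1}}\right)\ge\frac{y+1}{2}\cos\left(\frac{\theta_d}{2^{\nu+1}}\right)$; (4) $\xi_\nu\cos\left(\frac{\theta_d}{2^{\nu}}\right)+\eta_\nu\sin\left(\frac{\theta_d}{2^{\nu}}\right)\le\frac{y+1}{2}$; (5) $\xi_\nu\le\frac{y+1}{2}$. Then $D_\nu(\ell,u)$ is the set of $(x,y)\in B_{[\ell,u]}$ for which there exist $\{(\xi_j,\eta_j)\}_{j=1}^\nu$ satisfying (1)–(5), and $D^+_\nu(\ell,u)$ is the set of $(x,y)\in B_{[\ell,u]}$ with $y\ge x^2$ for which there exist $\{(\xi_j,\eta_j)\}_{j=1}^\nu$ satisfying (1), (2), (3). *)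

(* Defs.v *)
From Stdlib Require Import Reals Ensembles.
Open Scope R_scope.

Definition Sq (l u : R) : Ensemble (R * R) :=
  fun '(x, y) => y = x ^ 2 /\ l <= x <= u.

Definition B (l u : R) : Ensemble (R * R) :=
  fun '(x, y) => l <= x <= u /\ 0 <= y <= (l + u) * x - l * u.

(** The polar angle, in (-3 PI / 2, PI / 2), of the
    point (t, (t^2 - 1) / 2). *)
Definition Theta (t : R) : R :=
  match total_order_T t 0 with
  | inleft (left _) => atan ((t ^ 2 - 1) / (2 * t)) - PI
  | inleft (right _) => - (PI / 2)
  | inright _ => atan ((t ^ 2 - 1) / (2 * t))
  end.

Definition theta_min (l : R) : R := Theta l.
Definition theta_max (u : R) : R := Theta u.
Definition theta_mid (l u : R) : R := (theta_min l + theta_max u) / 2.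
Definition theta_d (l u : R) : R := theta_max u - theta_min l.

(** Clockwise rotation by [theta]. *)
Definition Rot (p : R * R) (theta : R) : R * R :=
  let '(v, w) := p in
  (cos theta * v + sin theta * w, - sin theta * v + cos theta * w).

Definition Fold (p : R * R) : R * R :=
  let '(v, w) := p in (v, Rabs w).

(** The finite families (xi_j), (eta_j), 1 <= j <= nu, are encoded as functions
    on [nat]; their values at the other indices are unconstrained. *)
Definition cond_init (l u x y : R) (xi eta : nat -> R) : Prop :=
  (xi 1%nat, eta 1%nat) = Fold (Rot (x, (y - 1) / 2) (theta_mid l u)).

Definition cond_step (nu : nat) (l u : R) (xi eta : nat -> R) : Prop :=
  forall j : nat, (1 <= j <= nu - 1)%nat ->
    (xi (j + 1)%nat, eta (j + 1)%nat)
      = Fold (Rot (xi j, eta j) (theta_d l u / 2 ^ (j + 1))).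

Definition cond_chord (nu : nat) (l u y : R) (xi eta : nat -> R) : Prop :=
  xi nu * cos (theta_d l u / 2 ^ (nu + 1))
    + eta nu * sin (theta_d l u / 2 ^ (nu + 1))
  >= (y + 1) / 2 * cos (theta_d l u / 2 ^ (nu + 1)).

Definition cond_tangent_rot (nu : nat) (l u y : R) (xi eta : nat -> R) : Prop :=
  xi nu * cos (theta_d l u / 2 ^ nu) + eta nu * sin (theta_d l u / 2 ^ nu)
  <= (y + 1) / 2.

Definition cond_tangent (nu : nat) (y : R) (xi : nat -> R) : Prop :=
  xi nu <= (y + 1) / 2.

Definition D (nu : nat) (l u : R) : Ensemble (R * R) :=
  fun '(x, y) =>
    B l u (x, y) /\
    exists xi eta : nat -> R,
      cond_init l u x y xi eta /\
      cond_step nu l u xi eta /\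
      cond_chord nu l u y xi eta /\
      cond_tangent_rot nu l u y xi eta /\
      cond_tangent nu y xi.

Definition Dplus (nu : nat) (l u : R) : Ensemble (R * R) :=
  fun '(x, y) =>
    B l u (x, y) /\
    y >= x ^ 2 /\
    exists xi eta : nat -> R,
      cond_init l u x y xi eta /\
      cond_step nu l u xi eta /\
      cond_chord nu l u y xi eta.

(* Main.v *)
(** Put [h = (y + 1) / 2] and let [r], [phi] be polar coordinates of the point
    [(x, (y - 1) / 2)].  Then [r ^ 2 - h ^ 2 = x ^ 2 - y], so the parabola is
    the circle [r = h].  Since [Theta t = 2 atan t - PI / 2], the arc over
    [[l, u]] is the sector of half-angle [theta_d / 2] about [theta_mid].
    Each rotate-and-fold step sends a polar angle [a >= 0] to
    [|a - theta_d / 2 ^ (j + 1)|], so the sector becomes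
    [[0, theta_d / 2 ^ nu]], while an angle outside it keeps a constant excess.
    With [delta = theta_d / 2 ^ (nu + 1)], a positive excess contradicts the
    last conditions unless [l = u]; otherwise they give
    [h cos delta <= r <= h / cos delta], whence
    [|y - x ^ 2| <= h ^ 2 tan ^ 2 delta] with [tan delta <= 4 / 2 ^ nu]. *)

Require Import Defs.
From Stdlib Require Import Reals Ensembles Lra Lia Psatz.
Open Scope R_scope.

(** * The angle [Theta] and the rational parametrization of the circle *)

Lemma sin_atan_eq (t : R) : sin (atan t) = t * cos (atan t).
Proof.
  pose proof (atan_bound t) as Hb.
  assert (Hc : 0 < cos (atan t)) by (apply cos_gt_0; lra).
  rewrite <- (tan_atan t) at 2.
  unfold tan. field. lra.
Qed.

Lemma cos_atan_sq (t : R) : (1 + t ^ 2) * cos (atan t) ^ 2 = 1.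
Proof.
  pose proof (sin2_cos2 (atan t)) as H. unfold Rsqr in H.
  rewrite sin_atan_eq in H. nra.
Qed.

(** Both [2 * atan t - PI / 2] and its shift by [PI] have tangent [(t ^ 2 - 1) / (2 * t)]. The one
    lying in [(- PI / 2, PI / 2)], where [atan] inverts [tan], is the former for [t > 0] and the
    latter for [t < 0]. *)
Lemma Theta_atan (t : R) : Theta t = 2 * atan t - PI / 2.
Proof.
  pose proof PI_RGT_0. pose proof (atan_bound t) as Hb.
  assert (Hc : 0 < cos (atan t)) by (apply cos_gt_0; lra).
  pose proof (sin_atan_eq t) as Hs.
  assert (S1 : sin (2 * atan t - PI / 2) = - cos (2 * atan t))
    by (rewrite sin_minus, cos_PI2, sin_PI2; ring).
  assert (C1 : cos (2 * atan t - PI / 2) = sin (2 * atan t))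
    by (rewrite cos_minus, cos_PI2, sin_PI2; ring).
  assert (S2 : sin (2 * atan t + PI / 2) = cos (2 * atan t))
    by (rewrite sin_plus, cos_PI2, sin_PI2; ring).
  assert (C2 : cos (2 * atan t + PI / 2) = - sin (2 * atan t))
    by (rewrite cos_plus, cos_PI2, sin_PI2; ring).
  unfold Theta. destruct (total_order_T t 0) as [[Ht|Ht]|Ht].
  - assert (atan t < 0) by (rewrite <- atan_0; apply atan_increasing; lra).
    replace ((t ^ 2 - 1) / (2 * t)) with (tan (2 * atan t + PI / 2)).
    + rewrite atan_tan; lra.
    + unfold tan. rewrite S2, C2, cos_2a, sin_2a, Hs. field. split; lra.
  - rewrite Ht, atan_0. lra.
  - assert (0 < atan t) by (rewrite <- atan_0; apply atan_increasing; lra).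
    replace ((t ^ 2 - 1) / (2 * t)) with (tan (2 * atan t - PI / 2)).
    + rewrite atan_tan; lra.
    + unfold tan. rewrite S1, C1, cos_2a, sin_2a, Hs. field. split; lra.
Qed.

(** Together with [sin_Theta], this puts the point [(t, (t ^ 2 - 1) / 2)] at radius
    [(t ^ 2 + 1) / 2] and angle [Theta t]. *)
Lemma cos_Theta (t : R) : cos (Theta t) * (1 + t ^ 2) = 2 * t.
Proof.
  rewrite Theta_atan, cos_minus, cos_PI2, sin_PI2, sin_2a, sin_atan_eq.
  transitivity (2 * t * ((1 + t ^ 2) * cos (atan t) ^ 2)); [ring|].
  rewrite cos_atan_sq. ring.
Qed.

Lemma sin_Theta (t : R) : sin (Theta t) * (1 + t ^ 2) = t ^ 2 - 1.
Proof.
  rewrite Theta_atan, sin_minus, cos_PI2, sin_PI2, cos_2a, sin_atan_eq.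
  transitivity ((t ^ 2 - 1) * ((1 + t ^ 2) * cos (atan t) ^ 2)); [ring|].
  rewrite cos_atan_sq. ring.
Qed.

Lemma Theta_increasing (s t : R) : s < t -> Theta s < Theta t.
Proof.
  intros H. rewrite !Theta_atan. pose proof (atan_increasing s t H). lra.
Qed.

Lemma Theta_le (s t : R) : s <= t -> Theta s <= Theta t.
Proof.
  intros [H | ->]; [left; now apply Theta_increasing | lra].
Qed.

Lemma theta_d_bounds (l u : R) : l <= u -> 0 <= theta_d l u < 2 * PI.
Proof.
  intros H. unfold theta_d, theta_max, theta_min.
  pose proof (Theta_le l u H). rewrite !Theta_atan in *.
  pose proof (atan_bound l). pose proof (atan_bound u). lra.
Qed.

Lemma theta_d_pos (l u : R) : l < u -> 0 < theta_d l u.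
Proof.
  intros H. unfold theta_d, theta_max, theta_min.
  pose proof (Theta_increasing l u H). lra.
Qed.

(** * Rotations and folds in polar coordinates *)

Lemma div_pow2_S (d : R) (n : nat) : d / 2 ^ n = 2 * (d / 2 ^ (n + 1)).
Proof.
  rewrite pow_add. field. apply pow_nonzero; lra.
Qed.

Lemma div_pow2_nonneg (d : R) (n : nat) : 0 <= d -> 0 <= d / 2 ^ n.
Proof.
  intros H. apply Rle_mult_inv_pos; [lra | apply pow_lt; lra].
Qed.

Lemma div_pow2_antitone (d : R) (m n : nat) :
  0 <= d -> (m <= n)%nat -> d / 2 ^ n <= d / 2 ^ m.
Proof.
  intros Hd Hmn. apply Rmult_le_compat_l; [lra|].
  apply Rinv_le_contravar; [apply pow_lt; lra | apply Rle_pow; [lra | lia]].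
Qed.

Lemma Rot_polar (r a b : R) :
  Rot (r * cos a, r * sin a) b = (r * cos (a - b), r * sin (a - b)).
Proof.
  unfold Rot. rewrite cos_minus, sin_minus. f_equal; ring.
Qed.

(** On [[- PI, PI]] the sine has the sign of the angle, so reflecting into the upper half-plane
    takes the absolute value of the angle. *)
Lemma Fold_polar (r a : R) : 0 <= r -> - PI <= a <= PI ->
  Fold (r * cos a, r * sin a) = (r * cos (Rabs a), r * sin (Rabs a)).
Proof.
  intros Hr Ha. unfold Fold. f_equal.
  - unfold Rabs. destruct (Rcase_abs a); [now rewrite cos_neg | reflexivity].
  - unfold Rabs at 2. destruct (Rcase_abs a).
    + rewrite sin_neg.
      assert (0 <= sin (- a)) by (apply sin_ge_0; lra).
      rewrite sin_neg in H. rewrite Rabs_left1; nra.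
    + assert (0 <= sin a) by (apply sin_ge_0; lra).
      rewrite Rabs_pos_eq; nra.
Qed.

Lemma polar_upper_half (v w : R) : 0 <= w ->
  exists r a, 0 <= r /\ 0 <= a <= PI /\ v = r * cos a /\ w = r * sin a.
Proof.
  intros Hw. set (r := sqrt (v ^ 2 + w ^ 2)).
  assert (Hr0 : 0 <= r) by apply sqrt_pos.
  assert (Hr2 : r * r = v ^ 2 + w ^ 2) by (apply sqrt_sqrt; nra).
  destruct (Req_dec r 0) as [Hz | Hz].
  - exists 0, 0. pose proof PI_RGT_0. rewrite Hz in Hr2.
    repeat split; try lra; nra.
  - assert (Hr : 0 < r) by lra.
    set (q := v / r). assert (Hq : v = r * q) by (unfold q; field; lra).
    exists r, (acos q).
    pose proof (acos_bound q).
    assert (Hw2 : r * r * (1 - q * q) = w * w)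
      by (replace (r * r * (1 - q * q)) with (r * r - (r * q) * (r * q)) by ring;
          rewrite <- Hq, Hr2; ring).
    assert (Hq2 : 0 <= 1 - q * q).
    { apply Rmult_le_reg_l with (r * r); nra. }
    assert (Hc : cos (acos q) = q) by (apply cos_acos; nra).
    assert (Hs : 0 <= sin (acos q)) by (apply sin_ge_0; lra).
    pose proof (sin2_cos2 (acos q)) as H1. unfold Rsqr in H1.
    rewrite Hc in *. set (s := sin (acos q)) in *.
    repeat split; try lra.
    apply Rsqr_inj; [exact Hw | now apply Rmult_le_pos; lra |].
    unfold Rsqr. rewrite <- Hw2, <- H1. ring.
Qed.

(** With [b = theta_d l u / 2 ^ (j + 1)], the map [a -> |a - b|] sends [[0, 2 b]] into [[0, b]].
    Beyond [2 b] the difference is positive, the fold does nothing, and the excess over the sector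
    is preserved. *)
Lemma folded_angle (nu : nat) (l u r a1 : R) (xi eta : nat -> R) :
  0 <= r -> 0 <= a1 <= PI -> l <= u ->
  xi 1%nat = r * cos a1 -> eta 1%nat = r * sin a1 ->
  cond_step nu l u xi eta ->
  forall j : nat, (1 <= j <= nu)%nat ->
    exists a, 0 <= a <= PI /\ xi j = r * cos a /\ eta j = r * sin a /\
      (a1 <= theta_d l u / 2 -> a <= theta_d l u / 2 ^ j) /\
      (theta_d l u / 2 < a1 ->
        a = theta_d l u / 2 ^ j + (a1 - theta_d l u / 2)).
Proof.
  intros Hr Ha1 Hlu Hx1 He1 Hstep j.
  pose proof (theta_d_bounds l u Hlu) as Hd. set (d := theta_d l u) in *.
  induction j as [|j IH]; [lia|]. intros Hj.
  destruct (Nat.eq_dec j 0) as [-> | Hj0].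
  - exists a1. rewrite pow_1. repeat split; lra || auto; intros; lra.
  - destruct IH as (a & Ha & Hx & He & Hin & Hout); [lia|].
    specialize (Hstep j ltac:(lia)). fold d in Hstep.
    rewrite Hx, He, Rot_polar in Hstep.
    replace (S j) with (j + 1)%nat by lia.
    pose proof (div_pow2_S d j) as Hdj.
    pose proof (div_pow2_nonneg d (j + 1) ltac:(lra)) as Hdn.
    pose proof (div_pow2_antitone d 1 (j + 1) ltac:(lra) ltac:(lia)) as Hd1.
    rewrite pow_1 in Hd1.
    rewrite Fold_polar in Hstep by lra.
    injection Hstep as Hx' He'.
    exists (Rabs (a - d / 2 ^ (j + 1))).
    split; [split; [apply Rabs_pos | apply Rabs_le; lra]|].
    split; [exact Hx'|]. split; [exact He'|]. split.
    + intros H. specialize (Hin H). apply Rabs_le. lra.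
    + intros H. specialize (Hout H). rewrite Rabs_pos_eq; lra.
Qed.

Lemma folding_sequence_exists (nu : nat) (l u x y : R) :
  exists xi eta : nat -> R, cond_init l u x y xi eta /\ cond_step nu l u xi eta.
Proof.
  set (p := nat_rect (fun _ => (R * R)%type)
    (Fold (Rot (x, (y - 1) / 2) (theta_mid l u)))
    (* [p] counts from 0: its step at [j] leads from family index [j + 1] to [j + 2], hence the
       exponent. *)
    (fun j q => Fold (Rot q (theta_d l u / 2 ^ (j + 2))))).
  exists (fun j => fst (p (j - 1)%nat)), (fun j => snd (p (j - 1)%nat)).
  split.
  - unfold cond_init. now rewrite <- surjective_pairing.
  - intros j Hj. rewrite <- !surjective_pairing.
    destruct j as [|j]; [lia|].
    replace (S j + 1 - 1)%nat with (S j) by lia.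
    replace (S j - 1)%nat with j by lia.
    replace (S j + 1)%nat with (j + 2)%nat by lia.
    reflexivity.
Qed.

(** * The parabola arc satisfies the chord condition *)

Lemma cos_le_of_Rabs_le (a b : R) : Rabs a <= b -> b <= PI -> cos b <= cos a.
Proof.
  intros H Hb.
  replace (cos a) with (cos (Rabs a)).
  - pose proof (Rabs_pos a). apply cos_decr_1; lra.
  - unfold Rabs. destruct (Rcase_abs a); [apply cos_neg | reflexivity].
Qed.

Lemma Sq_subset_B (l u x y : R) : Sq l u (x, y) -> B l u (x, y).
Proof.
  intros [-> H]. unfold B. split; [lra | nra].
Qed.

(** On the parabola the radius is exactly [(y + 1) / 2], so the chord condition reduces to
    [cos delta <= cos (a - delta)], which holds because the folded angle [a] lies in
    [[0, 2 * delta]]. *)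
Lemma Sq_subset_Dplus (l u : R) (nu : nat) : l <= u -> (1 <= nu)%nat ->
  Included (R * R) (Sq l u) (Dplus nu l u).
Proof.
  intros Hlu Hnu [x y] HS. unfold In in *.
  pose proof (Sq_subset_B l u x y HS) as HB. destruct HS as [Hy Hx].
  split; [exact HB|]. split; [lra|].
  destruct (folding_sequence_exists nu l u x y) as (xi & eta & H1 & H2).
  exists xi, eta. split; [exact H1|]. split; [exact H2|].
  pose proof (theta_d_bounds l u Hlu) as Hd. pose proof PI_RGT_0.
  set (a1 := Rabs (Theta x - theta_mid l u)).
  assert (Hsec : - (theta_d l u / 2) <= Theta x - theta_mid l u
                 <= theta_d l u / 2).
  { pose proof (Theta_le l x ltac:(lra)). pose proof (Theta_le x u ltac:(lra)).
    unfold theta_mid, theta_d, theta_min, theta_max. lra. }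
  assert (Ha1 : a1 <= theta_d l u / 2) by now apply Rabs_le.
  assert (Ha0 : 0 <= a1) by apply Rabs_pos.
  assert (Hh : 0 <= (y + 1) / 2) by nra.
  unfold cond_init in H1.
  replace x with ((y + 1) / 2 * cos (Theta x)) in H1 at 1
    by (pose proof (cos_Theta x); rewrite Hy; lra).
  replace ((y - 1) / 2) with ((y + 1) / 2 * sin (Theta x)) in H1
    by (pose proof (sin_Theta x); rewrite Hy; lra).
  rewrite Rot_polar, Fold_polar in H1 by lra.
  fold a1 in H1. injection H1 as Hx1 He1.
  destruct (folded_angle nu l u _ a1 xi eta Hh ltac:(lra) Hlu Hx1 He1 H2 nu
              ltac:(lia)) as (a & Ha & Hxn & Hen & Hin & _).
  specialize (Hin Ha1).
  unfold cond_chord. rewrite Hxn, Hen.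
  set (d := theta_d l u) in *.
  rewrite div_pow2_S in Hin.
  pose proof (div_pow2_antitone d 1 (nu + 1) ltac:(lra) ltac:(lia)) as Hd1.
  rewrite pow_1 in Hd1.
  set (delta := d / 2 ^ (nu + 1)) in *.
  assert (Hc : cos delta <= cos (a - delta))
    by (apply cos_le_of_Rabs_le; [apply Rabs_le | ]; lra).
  rewrite cos_minus in Hc. nra.
Qed.

(** * Invariance of the norm, and the tangent conditions above the parabola *)

Lemma Fold_Rot_norm (p q : R * R) (b : R) :
  q = Fold (Rot p b) -> fst q ^ 2 + snd q ^ 2 = fst p ^ 2 + snd p ^ 2.
Proof.
  intros ->. destruct p as [v w]. cbn [Rot Fold fst snd].
  rewrite <- (Rsqr_pow2 (Rabs _)), <- Rsqr_abs, Rsqr_pow2.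
  pose proof (sin2_cos2 b) as H. unfold Rsqr in H.
  replace (v ^ 2 + w ^ 2) with ((sin b * sin b + cos b * cos b) * (v ^ 2 + w ^ 2))
    by (rewrite H; ring).
  ring.
Qed.

Lemma folding_norm (nu : nat) (l u x y : R) (xi eta : nat -> R) :
  cond_init l u x y xi eta -> cond_step nu l u xi eta ->
  forall j : nat, (1 <= j <= nu)%nat ->
    xi j ^ 2 + eta j ^ 2 = x ^ 2 + ((y - 1) / 2) ^ 2.
Proof.
  intros H1 H2 j. induction j as [|j IH]; [lia|]. intros Hj.
  destruct (Nat.eq_dec j 0) as [-> | Hj0].
  - exact (Fold_Rot_norm _ _ _ H1).
  - rewrite <- IH by lia. replace (S j) with (j + 1)%nat by lia.
    exact (Fold_Rot_norm _ _ _ (H2 j ltac:(lia))).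
Qed.

(** Cauchy-Schwarz against a unit vector: a disc of radius [h] lies in each of its tangent
    half-planes. Both tangent conditions follow from this once [y >= x ^ 2] bounds the norm by
    [(y + 1) / 2]. *)
Lemma dot_unit_le (v w b h : R) :
  0 <= h -> v ^ 2 + w ^ 2 <= h ^ 2 -> v * cos b + w * sin b <= h.
Proof.
  intros Hh H. pose proof (sin2_cos2 b) as Hsc. unfold Rsqr in Hsc.
  assert (E : (v * cos b + w * sin b) ^ 2 + (v * sin b - w * cos b) ^ 2
          = v ^ 2 + w ^ 2).
  { replace (v ^ 2 + w ^ 2)
      with ((sin b * sin b + cos b * cos b) * (v ^ 2 + w ^ 2))
      by (rewrite Hsc; ring). ring. }
  set (e := v * cos b + w * sin b) in *.
  pose proof (pow2_ge_0 (v * sin b - w * cos b)). nra.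
Qed.

Lemma Dplus_subset_D (l u : R) (nu : nat) : (1 <= nu)%nat ->
  Included (R * R) (Dplus nu l u) (D nu l u).
Proof.
  intros Hnu [x y] (HB & Hy & xi & eta & H1 & H2 & H3). unfold In.
  split; [exact HB|]. exists xi, eta. repeat split; auto; destruct HB as [_ HB].
  - pose proof (folding_norm nu l u x y xi eta H1 H2 nu ltac:(lia)).
    apply dot_unit_le; nra.
  - pose proof (folding_norm nu l u x y xi eta H1 H2 nu ltac:(lia)).
    unfold cond_tangent.
    (* The second tangent condition is the half-plane in direction 0. *)
    replace (xi nu) with (xi nu * cos 0 + eta nu * sin 0)
      by (rewrite cos_0, sin_0; ring).
    apply dot_unit_le; nra.
Qed.

(** * Estimates for the tangent of the final angle and for [y] *)

Lemma tan_PI_pow2 (n : nat) :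
  0 < tan (PI / 2 ^ (n + 2)) <= 1 / 2 ^ n.
Proof.
  pose proof PI_RGT_0.
  assert (Hp : forall k, 0 < tan (PI / 2 ^ (k + 2))).
  { intros k. apply tan_gt_0.
    - apply Rdiv_lt_0_compat; [lra | apply pow_lt; lra].
    - pose proof (div_pow2_antitone PI 2 (k + 2) ltac:(lra) ltac:(lia)). lra. }
  split; [apply Hp|].
  (* Starting from [tan (PI / 4) = 1], each halving of the angle at least halves the tangent, since
     [tan (2 a) = 2 tan a / (1 - tan a ^ 2) >= 2 tan a]. *)
  induction n as [|n IH].
  - replace (PI / 2 ^ (0 + 2)) with (PI / 4) by (simpl; field).
    rewrite tan_PI4. simpl. lra.
  - pose proof (Hp (S n)) as Hp1.
    replace (S n + 2)%nat with (n + 2 + 1)%nat in * by lia.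
    pose proof (div_pow2_S PI (n + 2)) as E.
    pose proof (div_pow2_antitone PI 2 (n + 2) ltac:(lra) ltac:(lia)) as Hb.
    pose proof (div_pow2_nonneg PI (n + 2 + 1) ltac:(lra)) as Hnn.
    set (a := PI / 2 ^ (n + 2 + 1)) in *. rewrite E in IH, Hb.
    assert (Ha : 0 < cos a) by (apply cos_gt_0; lra).
    assert (H2a : 0 < cos (2 * a)) by (apply cos_gt_0; lra).
    assert (Hq : 0 < 1 - tan a * tan a).
    { rewrite cos_2a in H2a.
      assert (Es : sin a = tan a * cos a) by (unfold tan; field; lra).
      rewrite Es in H2a.
      assert (0 < (cos a * cos a) * (1 - tan a * tan a)) by lra.
      nra. }
    replace (2 * a) with (a + a) in IH by ring.
    rewrite tan_plus in IH; try lra;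
      [| replace (a + a) with (2 * a) by ring; lra].
    assert (Ht : (tan a + tan a) / (1 - tan a * tan a) * (1 - tan a * tan a)
            = tan a + tan a) by (field; lra).
    set (q := (tan a + tan a) / (1 - tan a * tan a)) in *.
    assert (Hs : 1 / 2 ^ S n = 1 / 2 ^ n / 2)
      by (simpl; field; apply pow_nonzero; lra).
    rewrite Hs. nra.
Qed.

Lemma B_y_le (l u x y : R) : B l u (x, y) -> y <= Rmax (l ^ 2) (u ^ 2).
Proof.
  intros [Hx Hy].
  pose proof (Rmax_l (l ^ 2) (u ^ 2)). pose proof (Rmax_r (l ^ 2) (u ^ 2)).
  set (m := Rmax (l ^ 2) (u ^ 2)) in *.
  destruct (Req_dec l u) as [-> | Hne].
  { assert (x = u) as -> by lra. lra. }
  (* [(u - l) ((l + u) x - l u) = (u - x) l ^ 2 + (x - l) u ^ 2] *)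
  assert (0 <= (u - x) * (m - l ^ 2)) by nra.
  assert (0 <= (x - l) * (m - u ^ 2)) by nra.
  assert ((l + u) * x - l * u <= m); [|lra].
  apply Rmult_le_reg_l with (u - l); lra.
Qed.

(** * From the conditions on the last point to its radius *)

Lemma radius_of_angle (r h a delta : R) :
  0 <= r -> 0 < h -> 0 < delta <= PI / 4 -> 0 <= a <= 2 * delta ->
  h * cos delta <= r * cos (a - delta) ->
  r * cos (a - 2 * delta) <= h -> r * cos a <= h ->
  h * cos delta <= r /\ r * cos delta <= h.
Proof.
  intros Hr Hh Hd Ha H3 H4 H5. pose proof PI_RGT_0. split.
  - pose proof (COS_bound (a - delta)). nra.
  (* The angle is within [delta] of one of the two tangency directions [0] and [2 * delta]; that
     tangent gives the bound. *)
  - destruct (Rle_dec a delta) as [Hle | Hgt].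
    + assert (cos delta <= cos a)
        by (apply cos_le_of_Rabs_le; [apply Rabs_le | ]; lra).
      nra.
    + assert (cos delta <= cos (a - 2 * delta))
        by (apply cos_le_of_Rabs_le; [apply Rabs_le | ]; lra).
      nra.
Qed.

(** Outside the circle, [r ^ 2 - h ^ 2] is at most [h ^ 2 / cos ^ 2 - h ^ 2 = h ^ 2 tan ^ 2];
    inside, [h ^ 2 - r ^ 2] is at most [h ^ 2 sin ^ 2], which is no larger. *)
Lemma radius_sq_gap (r h delta : R) :
  0 <= r -> 0 < h -> 0 < cos delta -> h * cos delta <= r -> r * cos delta <= h ->
  Rabs (h ^ 2 - r ^ 2) <= (h * tan delta) ^ 2.
Proof.
  intros Hr Hh Hc Hlo Hup. pose proof (COS_bound delta) as Hc1.
  pose proof (sin2_cos2 delta) as Hsc. unfold Rsqr in Hsc.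
  assert (Es : sin delta = tan delta * cos delta) by (unfold tan; field; lra).
  rewrite Es in Hsc.
  set (t := tan delta) in *. set (c := cos delta) in *.
  assert (Hl2 : (h * c) ^ 2 <= r ^ 2)
    by (apply pow_incr; split; [apply Rmult_le_pos|]; lra).
  assert (Hu2 : (r * c) ^ 2 <= h ^ 2)
    by (apply pow_incr; split; [apply Rmult_le_pos|]; lra).
  assert (Hc2 : 0 < c * c <= 1) by nra.
  assert (Ht2 : 0 <= (h * t) ^ 2) by apply pow2_ge_0.
  assert (E : (h * t) ^ 2 * (c * c) = h ^ 2 - (h * c) ^ 2).
  { replace (h ^ 2) with (h ^ 2 * (t * c * (t * c) + c * c))
      by (rewrite Hsc; ring). ring. }
  apply Rabs_le. split.
  - assert (r ^ 2 * (c * c) <= (h ^ 2 + (h * t) ^ 2) * (c * c)) by nra.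
    assert (r ^ 2 <= h ^ 2 + (h * t) ^ 2)
      by (apply Rmult_le_reg_r with (c * c); lra).
    lra.
  - nra.
Qed.

(** Expanding [cos (e + delta)] and using [r * cos e <= h] leaves [r * sin e * sin delta <= 0], so
    [r = 0], against [0 < h * cos delta]. *)
Lemma excess_angle_absurd (r h e delta : R) :
  0 <= r -> 0 < h -> 0 < e < PI -> 0 < delta < PI / 2 ->
  h * cos delta <= r * cos (e + delta) -> r * cos e <= h -> False.
Proof.
  intros Hr Hh He Hd H3 H4.
  assert (0 < cos delta) by (apply cos_gt_0; lra).
  assert (0 < sin delta) by (apply sin_gt_0; lra).
  assert (0 < sin e) by (apply sin_gt_0; lra).
  rewrite cos_plus in H3.
  assert (0 < sin e * sin delta) by now apply Rmult_lt_0_compat.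
  assert (0 < h * cos delta) by now apply Rmult_lt_0_compat.
  destruct (Req_dec r 0) as [Hr0 | Hr0]; [rewrite Hr0 in H3; lra|].
  assert (0 < r * (sin e * sin delta)) by (apply Rmult_lt_0_compat; lra).
  assert (r * cos e * cos delta <= h * cos delta)
    by (apply Rmult_le_compat_r; lra).
  lra.
Qed.

(** As [d < 2 * PI], the angle is below [PI / 2 ^ nu], and [tan_PI_pow2] at [nu - 2] gives
    [1 / 2 ^ (nu - 2) = 4 / 2 ^ nu]. *)
Lemma tan_small_angle (d : R) (nu : nat) : (2 <= nu)%nat -> 0 < d < 2 * PI ->
  0 < d / 2 ^ (nu + 1) <= PI / 4 /\ 0 <= tan (d / 2 ^ (nu + 1)) <= 4 / 2 ^ nu.
Proof.
  intros Hnu Hd. pose proof PI_RGT_0.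
  assert (Hpos : 0 < d / 2 ^ (nu + 1))
    by (apply Rdiv_lt_0_compat; [lra | apply pow_lt; lra]).
  assert (Hlt : d / 2 ^ (nu + 1) < PI / 2 ^ nu).
  { rewrite (div_pow2_S PI nu).
    replace (2 * (PI / 2 ^ (nu + 1))) with (2 * PI / 2 ^ (nu + 1))
      by (field; apply pow_nonzero; lra).
    apply Rmult_lt_compat_r; [apply Rinv_0_lt_compat, pow_lt|]; lra. }
  pose proof (div_pow2_antitone PI 2 nu ltac:(lra) Hnu) as Hq.
  assert (PI / 2 ^ 2 = PI / 4) by (simpl; field).
  split; [lra|]. split.
  - left. apply tan_gt_0; lra.
  - pose proof (tan_increasing (d / 2 ^ (nu + 1)) (PI / 2 ^ nu)
                  ltac:(lra) Hlt ltac:(lra)) as Ht.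
    pose proof (tan_PI_pow2 (nu - 2)) as Hb.
    replace (nu - 2 + 2)%nat with nu in Hb by lia.
    replace (4 / 2 ^ nu) with (1 / 2 ^ (nu - 2)); [lra|].
    replace nu with (nu - 2 + 2)%nat at 2 by lia.
    rewrite pow_add. simpl. field. apply pow_nonzero; lra.
Qed.

(** All rotations after the first are by angle 0, so [xi] is constant and [cond_tangent] is the
    half-plane of the parabola's tangent at [l]. At [x = l] it gives [y >= l ^ 2], while [B] gives
    the converse. *)
Lemma D_degenerate (l y x : R) (nu : nat) : (1 <= nu)%nat ->
  D nu l l (x, y) -> y = x ^ 2.
Proof.
  intros Hnu ([Hx Hy] & xi & eta & H1 & H2 & _ & _ & H5).
  assert (x = l) as -> by lra.
  assert (Hd : theta_d l l = 0) by (unfold theta_d, theta_max, theta_min; ring).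
  assert (Hconst : forall j, (1 <= j <= nu)%nat -> xi j = xi 1%nat).
  { intros j. induction j as [|j IH]; [lia|]. intros Hj.
    destruct (Nat.eq_dec j 0) as [-> | Hj0]; [reflexivity|].
    rewrite <- IH by lia. specialize (H2 j ltac:(lia)).
    rewrite Hd in H2. unfold Rdiv in H2. rewrite Rmult_0_l in H2.
    cbn [Rot Fold] in H2. rewrite cos_0, sin_0 in H2.
    replace (S j) with (j + 1)%nat by lia. injection H2 as H2 _.
    rewrite H2. ring. }
  unfold cond_tangent in H5. rewrite Hconst in H5 by lia.
  unfold cond_init in H1. cbn [Rot Fold] in H1. injection H1 as H1 _.
  rewrite H1 in H5.
  replace (theta_mid l l) with (Theta l) in H5
    by (unfold theta_mid, theta_max, theta_min; field).
  pose proof (cos_Theta l) as Hc. pose proof (sin_Theta l) as Hs.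
  apply (Rmult_le_compat_r (1 + l ^ 2)) in H5; [|nra].
  assert (2 * l * l + (l ^ 2 - 1) * ((y - 1) / 2)
          <= (y + 1) / 2 * (1 + l ^ 2)).
  { rewrite <- Hc, <- Hs. lra. }
  nra.
Qed.

Lemma D_gap_angle (l u x y : R) (nu : nat) : l < u -> (2 <= nu)%nat ->
  D nu l u (x, y) ->
  Rabs (y - x ^ 2) <= ((y + 1) / 2 * tan (theta_d l u / 2 ^ (nu + 1))) ^ 2.
Proof.
  intros Hlu Hnu ([Hx Hy] & xi & eta & H1 & H2 & H3 & H4 & H5).
  pose proof PI_RGT_0.
  pose proof (theta_d_bounds l u ltac:(lra)) as Hd.
  pose proof (theta_d_pos l u Hlu) as Hdp.
  pose proof (folding_norm nu l u x y xi eta H1 H2 nu ltac:(lia)) as Hnorm.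
  assert (He1 : 0 <= eta 1%nat).
  { unfold cond_init in H1. cbn [Rot Fold] in H1. injection H1 as _ H1.
    rewrite H1. apply Rabs_pos. }
  destruct (polar_upper_half (xi 1%nat) (eta 1%nat) He1)
    as (r & a1 & Hr & Ha1 & Hx1 & He1').
  destruct (folded_angle nu l u r a1 xi eta Hr Ha1 ltac:(lra) Hx1 He1' H2 nu
              ltac:(lia)) as (a & Ha & Hxn & Hen & Hin & Hout).
  unfold cond_chord, cond_tangent_rot, cond_tangent in *.
  rewrite Hxn, Hen in *.
  pose proof (tan_small_angle (theta_d l u) nu Hnu ltac:(lra)) as [Hdel _].
  rewrite div_pow2_S in H4, Hin, Hout.
  set (d := theta_d l u) in *. set (delta := d / 2 ^ (nu + 1)) in *.
  set (h := (y + 1) / 2) in *.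
  assert (Hh : 0 < h) by (unfold h; lra).
  assert (H3' : h * cos delta <= r * cos (a - delta))
    by (rewrite cos_minus; lra).
  assert (H4' : r * cos (a - 2 * delta) <= h)
    by (rewrite cos_minus; lra).
  (* The radius of the last point is that of the original one, which turns [h ^ 2 - r ^ 2] into
     [y - x ^ 2]. *)
  assert (Hr2 : r ^ 2 = x ^ 2 + ((y - 1) / 2) ^ 2).
  { rewrite <- Hnorm. pose proof (sin2_cos2 a) as Hsc. unfold Rsqr in Hsc.
    transitivity (r ^ 2 * (sin a * sin a + cos a * cos a));
      [rewrite Hsc; ring | ring]. }
  replace (y - x ^ 2) with (h ^ 2 - r ^ 2) by (rewrite Hr2; unfold h; field).
  destruct (Rle_dec a1 (d / 2)) as [Hle | Hgt].
  - specialize (Hin Hle).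
    destruct (radius_of_angle r h a delta) as [Hlo Hup]; try lra.
    apply radius_sq_gap; try lra. apply cos_gt_0; lra.
  - specialize (Hout ltac:(lra)). exfalso.
    (* The excess [a1 - d / 2] equals [a - 2 * delta]: the chord condition is read at excess plus
       [delta], the rotated tangent at the excess itself. *)
    apply (excess_angle_absurd r h (a1 - d / 2) delta); try lra.
    + replace (a1 - d / 2 + delta) with (a - delta) by lra. lra.
    + replace (a1 - d / 2) with (a - 2 * delta) by lra. lra.
Qed.

(** * Error bounds in terms of [l], [u] and [nu] *)

Lemma D_gap (l u x y : R) (nu : nat) : l <= u -> (2 <= nu)%nat ->
  D nu l u (x, y) ->
  Rabs (y - x ^ 2) <= ((Rmax (l ^ 2) (u ^ 2) + 1) / 2 ^ (nu - 1)) ^ 2.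
Proof.
  intros Hlu Hnu HD.
  destruct (Req_dec l u) as [<- | Hne].
  - rewrite (D_degenerate l y x nu ltac:(lia) HD).
    rewrite Rminus_diag, Rabs_R0. apply pow2_ge_0.
  - pose proof (D_gap_angle l u x y nu ltac:(lra) Hnu HD) as Hgap.
    destruct HD as [HB _]. pose proof (B_y_le l u x y HB) as Hm.
    destruct HB as [_ Hy].
    pose proof (theta_d_bounds l u Hlu) as Hd.
    pose proof (theta_d_pos l u ltac:(lra)) as Hdp.
    destruct (tan_small_angle (theta_d l u) nu Hnu ltac:(lra)) as [_ Ht].
    eapply Rle_trans; [exact Hgap|].
    apply pow_incr. split; [apply Rmult_le_pos; lra|].
    (* The first factor below bounds [(y + 1) / 2], the second bounds the tangent. *)
    replace ((Rmax (l ^ 2) (u ^ 2) + 1) / 2 ^ (nu - 1))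
      with ((Rmax (l ^ 2) (u ^ 2) + 1) / 2 * (4 / 2 ^ nu)).
    + apply Rmult_le_compat; lra.
    + replace nu with (nu - 1 + 1)%nat at 1 by lia.
      rewrite pow_add. simpl. field. apply pow_nonzero; lra.
Qed.

(** The gap [|sqrt y - |x||] is at most [sqrt y + |x|], and their product is [|y - x ^ 2|]; hence
    the square of the gap is at most [b ^ 2]. *)
Lemma sqrt_gap_le (x y b : R) : 0 <= y -> 0 <= b ->
  Rabs (y - x ^ 2) <= b ^ 2 -> Rabs (sqrt y - Rabs x) <= b.
Proof.
  intros Hy Hb H.
  pose proof (sqrt_pos y) as Hs. pose proof (Rabs_pos x) as Hx.
  pose proof (sqrt_sqrt y Hy) as Hss.
  assert (Hxx : Rabs x * Rabs x = x ^ 2)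
    by (rewrite <- (pow2_abs x); ring).
  pose proof (Rle_abs (y - x ^ 2)). pose proof (Rle_abs (- (y - x ^ 2))) as H'.
  rewrite Rabs_Ropp in H'.
  apply Rabs_le. split; nra.
Qed.

Lemma D_bounds (l u x y : R) (nu : nat) : l <= u -> (2 <= nu)%nat ->
  D nu l u (x, y) ->
  Rabs (sqrt y - Rabs x) <= (Rmax (l ^ 2) (u ^ 2) + 1) / 2 ^ (nu - 1) /\
  Rabs (y - x ^ 2) <= (Rmax (l ^ 2) (u ^ 2) + 1) ^ 2 / 2 ^ (2 * nu - 2).
Proof.
  intros Hlu Hnu HD.
  pose proof (D_gap l u x y nu Hlu Hnu HD) as Hgap.
  destruct HD as [[_ Hy] _]. split.
  - apply sqrt_gap_le; [lra | | exact Hgap].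
    apply div_pow2_nonneg. pose proof (Rmax_l (l ^ 2) (u ^ 2)).
    pose proof (pow2_ge_0 l). lra.
  - replace (2 * nu - 2)%nat with ((nu - 1) * 2)%nat by lia.
    rewrite pow_mult.
    replace ((Rmax (l ^ 2) (u ^ 2) + 1) ^ 2 / (2 ^ (nu - 1)) ^ 2)
      with (((Rmax (l ^ 2) (u ^ 2) + 1) / 2 ^ (nu - 1)) ^ 2)
      by (field; apply pow_nonzero; lra).
    exact Hgap.
Qed.

Theorem theorem1 (l u : R) (nu : nat) (hlu : l <= u) (hnu : (1 <= nu)%nat) :
  Included (R * R) (Sq l u) (Dplus nu l u) /\
  Included (R * R) (Dplus nu l u) (D nu l u) /\
  ((2 <= nu)%nat ->
    (forall x y : R, In (R * R) (D nu l u) (x, y) ->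
      Rabs (sqrt y - Rabs x) <= (Rmax (l ^ 2) (u ^ 2) + 1) / 2 ^ (nu - 1) /\
      Rabs (y - x ^ 2)
        <= (Rmax (l ^ 2) (u ^ 2) + 1) ^ 2 / 2 ^ (2 * nu - 2)) /\
    (forall x y : R, In (R * R) (Dplus nu l u) (x, y) ->
      y >= x ^ 2 /\
      Rabs (sqrt y - Rabs x) <= (Rmax (l ^ 2) (u ^ 2) + 1) / 2 ^ (nu - 1) /\
      Rabs (y - x ^ 2)
        <= (Rmax (l ^ 2) (u ^ 2) + 1) ^ 2 / 2 ^ (2 * nu - 2))).
Proof.
  split; [now apply Sq_subset_Dplus|].
  split; [now apply Dplus_subset_D|].
  intros Hnu. split.
  - intros x y H. now apply D_bounds.
  - intros x y H. split; [apply H|].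
    apply D_bounds; auto. now apply Dplus_subset_D.
Qed.
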